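(* Let $E=(E^0,E^1,r,s)$ be a graph, $H$ a (not necessarily separable) Hilbert space, and $\varphi:C^*(E)\to B(H)$ a permutative representation. Then there exist a set $\Lambda$ and a representation $\pi:C^*(E)\to B(\ell^2(\Lambda))$, arising from an $E$-branching system (on $\Lambda$ with counting measure, so that $L^2=\ell^2(\Lambda)$), such that $\varphi$ and $\pi$ are unitarily equivalent, i.e. there is a unitary $U:H\to\ell^2(\Lambda)$ with $U^*\pi(x)U=\varphi(x)$ for all $x\in C^*(E)$.
   Context: A graph $E=(E^0,E^1,r,s)$ consists of arbitrary sets $E^0$ (vertices) and $E^1$ (edges) and maps $r,s:E^1\to E^0$ (range and source). $C^*(E)$ is the universal $C^*$-algebra generated by mutually orthogonal projections $\{P_v\}_{v\in E^0}$ and partial isometries $\{S_e\}_{e\in E^1}$ with orthogonal ranges such that $S_e^*S_e=P_{r(e)}$ and $P_{s(e)}S_eS_e^*=S_eS_e^*$ for all $e\in E^1$, and $P_v=\sum_{e\in s^{-1}(v)}S_eS_e^*$ for every $v$ with $0<\#s^{-1}(v)<\infty$. A representation of $C^*(E)$ is a $*$-homomorphism $\varphi:C^*(E)\to B(H)$, $H$ a Hilbert space. Put $H_v=\varphi(P_v)(H)$ and $H_e=\varphi(S_e)\varphi(S_e)^*(H)$. Permutative: $\varphi$ is permutative if for every $e\in E^1$ and $v\in E^0$ there exist total orthonormal sets (orthonormal sets with dense span) $B_e\subseteq H_e$ and $B_v\subseteq H_v$ such that: if $e\in s^{-1}(v)$ then $B_e\subseteq B_v$; if $0<\#s^{-1}(v)<\infty$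 then $B_v=\bigcup_{e\in s^{-1}(v)}B_e$; and $\varphi(S_e)(B_{r(e)})=B_e$ for all $e\in E^1$. $E$-branching system: a measure space $(X,\mathcal M,\mu)$ together with collections of measurable subsets $\{R_e\}_{e\in E^1}$, $\{D_v\}_{v\in E^0}$ of $X$ and functions $f_e$, $f_e^{-1}$, $\Phi_{f_e}$, $\Phi_{f_e^{-1}}$ ($e\in E^1$) such that (equalities and inclusions of sets $\mu$-a.e. are understood up to $\mu$-null sets, and subsets of $X$ carry the induced $\sigma$-algebra and measure): (1) $R_e\cap R_f=\varnothing$ $\mu$-a.e. for $e\neq f$ in $E^1$; (2) $D_v\cap D_w=\varnothing$ $\mu$-a.e. for $v\neq w$ in $E^0$; (3) $R_e\subseteq D_{s(e)}$ $\mu$-a.e. for all $e\in E^1$; (4) $D_v=\bigcup_{e\in s^{-1}(v)}R_e$ $\mu$-a.e. for all $v\in E^0$ with $0<\# s^{-1}(v)<\infty$; (5) for each $e\in E^1$ there are measurable functions $f_e:D_{r(e)}\to R_e$ and $f_e^{-1}:R_e\to D_{r(e)}$ with $f_e(D_{r(e)})=R_e$ $\mu$-a.e., $f_e^{-1}\circ f_e=\mathrm{Id}_{D_{r(e)}}$ $\mu$-a.e. and $f_e\circ f_e^{-1}=\mathrm{Id}_{R_e}$ $\mu$-a.e.; (6) for each $e\in E^1$ there exist the Radon–Nikodym derivatives $\Phi_{f_e}=\frac{d(\mu\circ f_e)}{d\mu}$ (on $D_{r(e)}$) and $\Phi_{f_e^{-1}}=\frac{d(\mu\circ f_e^{-1})}{d\mu}$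 (on $R_e$), where $(\mu\circ f_e)(A)=\mu(f_e(A))$ and $(\mu\circ f_e^{-1})(B)=\mu(f_e^{-1}(B))$, and $(\Phi_{f_e^{-1}}\circ f_e)\cdot\Phi_{f_e}=1$ $\mu$-a.e. on $D_{r(e)}$ and $(\Phi_{f_e}\circ f_e^{-1})\cdot\Phi_{f_e^{-1}}=1$ $\mu$-a.e. on $R_e$. Representation arising from an $E$-branching system on $(X,\mathcal M,\mu)$: the representation $\pi:C^*(E)\to B(L^2(X,\mathcal M,\mu))$ determined by $\pi(S_e)(\phi)=\chi_{R_e}\cdot\Phi_{f_e^{-1}}^{1/2}\cdot(\phi\circ f_e^{-1})$ (understood as $0$ outside $R_e$) and $\pi(P_v)(\phi)=\chi_{D_v}\cdot\phi$ for $\phi\in L^2(X,\mathcal M,\mu)$. It is known that these formulas define a representation. *)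

(* Defs.v *)
From HB Require Import structures.
From mathcomp Require Import all_boot all_order all_algebra.
From mathcomp Require Import all_classical all_reals all_analysis.
From mathcomp Require Import measurable_realfun complex.
From mathcomp Require Import generic_quotient ring_quotient ring lra.

(* MathComp-Analysis; the complex field is R[i] for an arbitrary R : realType. *)

Set Implicit Arguments.
Unset Strict Implicit.
Unset Printing Implicit Defensive.
Import Order.TTheory GRing.Theory Num.Theory.
Import numFieldNormedType.Exports.
Local Open Scope classical_set_scope.
Local Open Scope ring_scope.

(* Inner products are linear in the first variable.  As for every normed module
   over R[i], the norm is a nonnegative real element of R[i]. *)

HB.mixin Record NormedModule_hasInner (R : realType) V
    & NormedModule R[i] V := {
  inner : V -> V -> R[i] ;
  inner_linearl : forall (a : R[i]) (x y z : V),
    inner (a *: x + y) z = a * inner x z + inner y z ;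
  inner_conj : forall x y : V, inner y x = (inner x y)^* ;
  inner_norm : forall x : V, inner x x = `|x| ^+ 2
}.

#[short(type="innerProductType")]
HB.structure Definition InnerProduct (R : realType) :=
  {V of NormedModule R[i] V & NormedModule_hasInner R V}.

#[short(type="hilbertType")]
HB.structure Definition Hilbert (R : realType) :=
  {V of InnerProduct R V & Complete V}.

(* An inner product on a mere R[i]-module induces the norm x |-> sqrt <x, x>. *)
Module InnerFactory.
Section CauchySchwarz.
Variables (C : numClosedFieldType) (V : lmodType C) (f : V -> V -> C).
Hypothesis fl : forall a x y z, f (a *: x + y) z = a * f x z + f y z.
Hypothesis fC : forall x y, f y x = (f x y)^*.
Hypothesis f_ge0 : forall x, 0 <= f x x.
Hypothesis f_eq0 : forall x, f x x = 0 -> x = 0.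

Lemma f0l z : f 0 z = 0.
Proof. by have := fl (-1) 0 0 z; rewrite scaler0 addr0 mulN1r addNr. Qed.

Lemma fDl x y z : f (x + y) z = f x z + f y z.
Proof. by have := fl 1 x y z; rewrite scale1r mul1r. Qed.

Lemma fZl a x z : f (a *: x) z = a * f x z.
Proof. by have := fl a x 0 z; rewrite f0l !addr0. Qed.

Lemma fDr x y z : f z (x + y) = f z x + f z y.
Proof. by rewrite !(fC _ z) fDl rmorphD. Qed.

Lemma fZr a x z : f z (a *: x) = a^* * f z x.
Proof. by rewrite !(fC _ z) fZl rmorphM. Qed.

Lemma cauchy_schwarz x y : `|f x y| ^+ 2 <= f x x * f y y.
Proof.
have [y0|ny0] := eqVneq (f y y) 0.
  by rewrite (f_eq0 y0) (fC 0 x) !f0l rmorph0 normr0 expr0n/= mulr0.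
have yy : 0 < f y y by rewrite lt0r ny0 f_ge0.
set c := f x y.
have := f_ge0 (f y y *: x - c *: y).
rewrite -scaleNr fDl !fDr !fZl !fZr rmorphN/= (fC x y) -/c.
rewrite -(fC y y).
have -> : f y y * (f y y * f x x) + f y y * (- c^* * c) +
  (- c * (f y y * c^*) + - c * (- c^* * f y y)) =
  f y y * (f x x * f y y - c * c^*).
  rewrite !mulNr !mulrN !opprK mulrBr.
  rewrite [- (c * _) + _]addrC.
  rewrite (mulrCA c (f y y)) [c * (c^* * _)]mulrA [c * c^* * f y y]mulrC addrN addr0.
  by rewrite [f x x * _]mulrC [c^* * c]mulrC.
by rewrite pmulr_rge0// subr_ge0 normCK.
Qed.

Definition fnorm x := sqrtC (f x x).

Lemma fnorm_triangle x y : fnorm (x + y) <= fnorm x + fnorm y.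
Proof.
rewrite -(@ler_pXn2r _ 2)// ?nnegrE ?addr_ge0 ?sqrtC_ge0//.
rewrite sqrrD !sqrtCK fDl !fDr (fC x y).
have -> : f x x + f x y + ((f x y)^* + f y y) =
  f x x + (f x y + (f x y)^*) + f y y by rewrite !addrA.
rewrite lerD2r lerD2l.
have -> : f x y + (f x y)^* = 'Re (f x y) *+ 2.
  by rewrite ReE -mulr_natr divfK// pnatr_eq0.
rewrite lerMn2r/=; apply: le_trans (leif_Re_Creal _) _.
rewrite -(@ler_pXn2r _ 2)// ?nnegrE ?mulr_ge0 ?sqrtC_ge0//.
by rewrite exprMn !sqrtCK cauchy_schwarz.
Qed.

Lemma fnormZ a x : fnorm (a *: x) = `|a| * fnorm x.
Proof.
rewrite /fnorm fZl fZr mulrA -normCK sqrtCM ?nnegrE ?exprn_ge0//.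
by rewrite sqrCK.
Qed.

Lemma fnorm_eq0 x : fnorm x = 0 -> x = 0.
Proof. by move=> /eqP; rewrite sqrtC_eq0 => /eqP/f_eq0. Qed.
End CauchySchwarz.
End InnerFactory.

HB.factory Record Lmodule_hasInner (R : realType) V & GRing.Lmodule R[i] V := {
  inner : V -> V -> R[i] ;
  inner_linearl : forall (a : R[i]) (x y z : V),
    inner (a *: x + y) z = a * inner x z + inner y z ;
  inner_conj : forall x y : V, inner y x = (inner x y)^* ;
  inner_ge0 : forall x : V, 0 <= inner x x ;
  inner_eq0 : forall x : V, inner x x = 0 -> x = 0
}.

HB.builders Context R V & Lmodule_hasInner R V.
Import InnerFactory.
HB.instance Definition _ := Lmodule_isNormed.Build R[i] V
  (fnorm_triangle inner_linearl inner_conj inner_ge0 inner_eq0)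
  (fnormZ inner_linearl inner_conj inner_ge0)
  (fnorm_eq0 inner_eq0).
Lemma inner_norm x : inner x x = `|x| ^+ 2.
Proof. by rewrite sqrtCK. Qed.
HB.instance Definition _ :=
  NormedModule_hasInner.Build R V inner_linearl inner_conj inner_norm.
HB.end.

Local Open Scope complex_scope.

Definition sqnormc (R : realType) (z : R[i]) : R := Normc.normc z ^+ 2.

(* A measure space (X, M, mu) is given by a measurable subset X of a measurable
   type T and a measure on T, X carrying the induced sigma-algebra and measure:
   measurable types are pointed, and X = set0 is needed for the zero Hilbert
   space.  A complex function is measurable when its two components are. *)
Section sq_integrable.
Context d (T : measurableType d) (R : realType).
Context (mu : {measure set T -> \bar R}) (X : set T) (mX : measurable X).

Definition sq_integrable (_ : measurable X) : {pred T -> R[i]} := mem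
  [set f : T -> R[i] | [/\ measurable_fun X (fun x => complex.Re (f x)),
     measurable_fun X (fun x => complex.Im (f x))
   & (\int[mu]_(x in X) (sqnormc (f x))%:E < +oo)%E]].

Lemma sqnormcE (z : R[i]) :
  sqnormc z = complex.Re z ^+ 2 + complex.Im z ^+ 2.
Proof. by case: z => a b; rewrite /sqnormc/= sqr_sqrtr// addr_ge0 ?sqr_ge0. Qed.

Let mReIm (f : T -> R[i]) : measurable_fun X (fun x => complex.Re (f x)) ->
  measurable_fun X (fun x => complex.Im (f x)) ->
  measurable_fun X (EFin \o (fun x => sqnormc (f x))).
Proof.
move=> mR mI; apply/measurable_EFinP.
under eq_fun do rewrite sqnormcE.
by apply: measurable_funD; exact: measurable_funX.
Qed.

Lemma sq_integrableP f : f \in sq_integrable mX <->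
  [/\ measurable_fun X (fun x => complex.Re (f x)), measurable_fun X (fun x => complex.Im (f x))
    & mu.-integrable X (EFin \o (fun x => sqnormc (f x)))].
Proof.
rewrite inE/=; split=> -[mR mI fi]; split=> //.
- apply/integrableP; split; first exact: mReIm.
  apply: le_lt_trans fi; apply: ge0_le_integral => //.
  + by apply: measurableT_comp => //; exact: mReIm.
  + exact: mReIm.
  + by move=> x _; rewrite gee0_abs// lee_fin sqr_ge0.
- move/integrableP: fi => [_ fi]; apply: le_lt_trans fi; apply: ge0_le_integral => //.
  + by move=> x _; rewrite lee_fin sqr_ge0.
  + exact: mReIm.
  + by apply: measurableT_comp => //; exact: mReIm.
  + by move=> x _; rewrite lee_abs.
Qed.

Lemma sq_integrable_submod : submod_closed (sq_integrable mX).
Proof.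
split.
  apply/sq_integrableP; split; [exact: measurable_cst|exact: measurable_cst|].
  rewrite (_ : _ \o _ = cst 0%E); first exact: integrable0.
  by apply/funext => x /=; rewrite sqnormcE/= expr0n/= addr0.
move=> a f g /sq_integrableP[fR fI fi] /sq_integrableP[gR gI gi].
have ER x : complex.Re ((a *: f + g) x) =
    complex.Re a * complex.Re (f x) - complex.Im a * complex.Im (f x) + complex.Re (g x).
  by rewrite [(a *: f + g) x]/(a * f x + g x); move: a (f x) (g x) => [? ?] [? ?] [? ?].
have EI x : complex.Im ((a *: f + g) x) =
    complex.Re a * complex.Im (f x) + complex.Im a * complex.Re (f x) + complex.Im (g x).
  by rewrite [(a *: f + g) x]/(a * f x + g x) {ER}; move: a (f x) (g x) => [? ?] [? ?] [? ?].
have mR : measurable_fun X (fun x => complex.Re ((a *: f + g) x)).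
  rewrite (eq_fun ER).
  apply: measurable_funD => //; apply: measurable_funB;
    by apply: measurable_funM.
have mI : measurable_fun X (fun x => complex.Im ((a *: f + g) x)).
  rewrite (eq_fun EI).
  by apply: measurable_funD => //; apply: measurable_funD; apply: measurable_funM.
apply/sq_integrableP; split => //.
pose h x := (2 * sqnormc a * sqnormc (f x)
             + 2 * sqnormc (g x))%R.
apply: (@le_integrable _ _ _ mu X mX _ (EFin \o h)).
- exact: mReIm.
- move=> x _ /=; have n0 (z : R[i]) : 0 <= sqnormc z by exact: sqr_ge0.
  have h0 : 0 <= h x by apply: addr_ge0; [apply: mulr_ge0; [apply: mulr_ge0 => //; exact: n0|exact: n0]|apply: mulr_ge0 => //; exact: n0].
  rewrite lee_fin (ger0_norm (n0 _)) (ger0_norm h0).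
  rewrite /h !sqnormcE ER EI.
  set a1 := complex.Re a; set a2 := complex.Im a.
  set f1 := complex.Re (f x); set f2 := complex.Im (f x).
  set g1 := complex.Re (g x); set g2 := complex.Im (g x).
  have := sqr_ge0 (a1 * f1 - a2 * f2 - g1).
  have := sqr_ge0 (a1 * f2 + a2 * f1 - g2).
  rewrite !expr2; nra.
- exact: (integrableD mX (integrableZl mX (2 * sqnormc a) fi) (integrableZl mX 2 gi)).
Qed.

HB.instance Definition _ := GRing.isSubmodClosed.Build R[i] (T -> R[i])
  (sq_integrable mX) sq_integrable_submod.

Definition sq_integrable_fun := {f : T -> R[i] | f \in sq_integrable mX}.
HB.instance Definition _ := [isSub of sq_integrable_fun for @proj1_sig _ _].
HB.instance Definition _ := [Choice of sq_integrable_fun by <:].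
HB.instance Definition _ :=
  [SubChoice_isSubLmodule of sq_integrable_fun by <:].

Definition ae_null : {pred sq_integrable_fun} := mem
  [set f : sq_integrable_fun | \forall x \ae mu, X x -> val f x = 0].

Lemma ae_null_zmod : zmod_closed ae_null.
Proof.
split; first by rewrite inE/=; apply: filterE => x _.
move=> f g; rewrite !inE/= => f0 g0.
apply: filterS2 f0 g0 => x f0 g0 Xx.
transitivity (sval f x - sval g x) => //; by rewrite (f0 Xx) (g0 Xx) subrr.
Qed.

HB.instance Definition _ := GRing.isZmodClosed.Build sq_integrable_fun
  ae_null ae_null_zmod.

(* L^2(X, M, mu; C), as a quotient by a.e. equality on X *)
Definition L2 := Quotient.quot ae_null.
HB.instance Definition _ := GRing.Zmodule.on L2.

Definition L2_class (f : sq_integrable_fun) : L2 := \pi_L2%qT f.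
(* an arbitrary representative, square integrable on X *)
Definition L2_fun (q : L2) : T -> R[i] := val (repr q : sq_integrable_fun).

Lemma eq_L2_class (f g : sq_integrable_fun) :
  L2_class f = L2_class g <-> val f = val g %[ae mu in X].
Proof.
have fgE x : (val (f - g)) x = val f x - val g x by [].
split=> [/eqP|fg].
  rewrite -[_ == _](Quotient.idealrBE ae_null) inE/=.
  apply: filterS => x fg Xx; apply/eqP; rewrite -subr_eq0.
  exact/eqP/(fg Xx).
apply/eqP; rewrite -[_ == _](Quotient.idealrBE ae_null) inE/=.
apply: filterS fg => x fg Xx.
by apply: etrans (fgE x) _; rewrite (fg Xx) subrr.
Qed.

Lemma L2_sq_integrable (q : L2) : L2_fun q \in sq_integrable mX.
Proof. exact: valP. Qed.

Lemma L2_classK (f : sq_integrable_fun) :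
  L2_fun (L2_class f) = val f %[ae mu in X].
Proof. by apply/eq_L2_class; rewrite /L2_class reprK. Qed.

Lemma eq_L2 (q r : L2) : q = r <-> L2_fun q = L2_fun r %[ae mu in X].
Proof. by rewrite -eq_L2_class /L2_class !reprK. Qed.

Lemma L2_class_add (f g : sq_integrable_fun) :
  L2_class (f + g) = L2_class f + L2_class g.
Proof. exact: (@Quotient.pi_add _ ae_null f g). Qed.

Definition L2_scale (a : R[i]) (q : L2) : L2 :=
  L2_class (a *: (repr q : sq_integrable_fun)).

Lemma L2_scaleE a (f : sq_integrable_fun) :
  L2_scale a (L2_class f) = L2_class (a *: f).
Proof.
apply/eq_L2_class; apply: filterS (L2_classK f) => x fx Xx.
by transitivity (a * L2_fun (L2_class f) x) => //; rewrite (fx Xx).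
Qed.

Lemma L2_reprK (q : L2) : L2_class (repr q) = q.
Proof. exact: reprK. Qed.

Fact L2_scalerA a b q : L2_scale a (L2_scale b q) = L2_scale (a * b) q.
Proof. by rewrite -(L2_reprK q) !L2_scaleE scalerA. Qed.
Fact L2_scale1r : left_id 1 L2_scale.
Proof. by move=> q; rewrite -(L2_reprK q) L2_scaleE scale1r. Qed.
Fact L2_scalerDr : right_distributive L2_scale +%R.
Proof.
move=> a q r; rewrite -(L2_reprK q) -(L2_reprK r).
by rewrite -L2_class_add !L2_scaleE scalerDr L2_class_add.
Qed.
Fact L2_scalerDl q : {morph L2_scale^~ q : a b / a + b}.
Proof.
by move=> a b; rewrite -(L2_reprK q) !L2_scaleE scalerDl L2_class_add.
Qed.
HB.instance Definition _ := GRing.Zmodule_isLmodule.Build R[i] L2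
  L2_scalerA L2_scale1r L2_scalerDr L2_scalerDl.

Lemma L2_linear a (q r : L2) :
  L2_fun (a *: q + r) = a *: L2_fun q + L2_fun r %[ae mu in X].
Proof.
have -> : a *: q + r = L2_class (a *: (repr q : sq_integrable_fun) + repr r).
  by rewrite L2_class_add L2_reprK.
exact: L2_classK.
Qed.

Definition L2_inner (q r : L2) : R[i] :=
  (\int[mu]_(x in X) complex.Re (L2_fun q x * (L2_fun r x)^*)) +i*
  (\int[mu]_(x in X) complex.Im (L2_fun q x * (L2_fun r x)^*)).

Section prod.
Variables f g : T -> R[i].
Hypotheses (fL2 : f \in sq_integrable mX) (gL2 : g \in sq_integrable mX).

Lemma Re_prodE x : complex.Re (f x * (g x)^*) =
  complex.Re (f x) * complex.Re (g x) + complex.Im (f x) * complex.Im (g x).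
Proof. by move: (f x) (g x) => [? ?] [? ?] /=; rewrite mulrN opprK. Qed.

Lemma Im_prodE x : complex.Im (f x * (g x)^*) =
  complex.Im (f x) * complex.Re (g x) - complex.Re (f x) * complex.Im (g x).
Proof. by move: (f x) (g x) => [? ?] [? ?] /=; rewrite mulrN addrC. Qed.

Let mRe : measurable_fun X (fun x => complex.Re (f x * (g x)^*)).
Proof.
have /sq_integrableP[fR fI _] := fL2; have /sq_integrableP[gR gI _] := gL2.
rewrite (eq_fun Re_prodE).
by apply: measurable_funD => //; apply: measurable_funM.
Qed.

Let mIm : measurable_fun X (fun x => complex.Im (f x * (g x)^*)).
Proof.
have /sq_integrableP[fR fI _] := fL2; have /sq_integrableP[gR gI _] := gL2.
rewrite (eq_fun Im_prodE).
by apply: measurable_funB => //; apply: measurable_funM.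
Qed.

Let intS : mu.-integrable X (EFin \o (fun x => sqnormc (f x) + sqnormc (g x))).
Proof.
have /sq_integrableP[_ _ fi] := fL2; have /sq_integrableP[_ _ gi] := gL2.
exact: (integrableD mX fi gi).
Qed.

Lemma integrable_Re_prod :
  mu.-integrable X (EFin \o (fun x => complex.Re (f x * (g x)^*))).
Proof.
apply: le_integrable intS => //; first exact/measurable_EFinP.
move=> x _ /=; rewrite lee_fin Re_prodE !sqnormcE.
rewrite [leRHS]ger0_norm; last by rewrite !addr_ge0 ?sqr_ge0.
set f1 := complex.Re (f x); set f2 := complex.Im (f x).
set g1 := complex.Re (g x); set g2 := complex.Im (g x).
have := sqr_ge0 (f1 - g1); have := sqr_ge0 (f2 - g2).
have := sqr_ge0 (f1 + g1); have := sqr_ge0 (f2 + g2).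
have := sqr_ge0 f1; have := sqr_ge0 f2; have := sqr_ge0 g1; have := sqr_ge0 g2.
by rewrite !expr2 ler_norml => *; apply/andP; split; nra.
Qed.

Lemma integrable_Im_prod :
  mu.-integrable X (EFin \o (fun x => complex.Im (f x * (g x)^*))).
Proof.
apply: le_integrable intS => //; first exact/measurable_EFinP.
move=> x _ /=; rewrite lee_fin Im_prodE !sqnormcE.
rewrite [leRHS]ger0_norm; last by rewrite !addr_ge0 ?sqr_ge0.
set f1 := complex.Re (f x); set f2 := complex.Im (f x).
set g1 := complex.Re (g x); set g2 := complex.Im (g x).
have := sqr_ge0 (f1 - g2); have := sqr_ge0 (f2 - g1).
have := sqr_ge0 (f1 + g2); have := sqr_ge0 (f2 + g1).
have := sqr_ge0 f1; have := sqr_ge0 f2; have := sqr_ge0 g1; have := sqr_ge0 g2.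
by rewrite !expr2 ler_norml => *; apply/andP; split; nra.
Qed.
End prod.

Lemma ae_eq_Rint (u v : T -> R) :
  mu.-integrable X (EFin \o u) -> mu.-integrable X (EFin \o v) ->
  u = v %[ae mu in X] -> \int[mu]_(x in X) u x = \int[mu]_(x in X) v x.
Proof.
move=> iu iv uv; congr fine; apply: ae_eq_integral => //.
- exact: measurable_int iu.
- exact: measurable_int iv.
- by apply: filterS uv => x /[apply] ->.
Qed.

Fact L2_inner_linearl a (q r s : L2) :
  L2_inner (a *: q + r) s = a * L2_inner q s + L2_inner r s.
Proof.
have := L2_linear a q r.
set t := a *: q + r => tE.
have iR u := integrable_Re_prod (L2_sq_integrable u) (L2_sq_integrable s).
have iI u := integrable_Im_prod (L2_sq_integrable u) (L2_sq_integrable s).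
have H (u v w : T -> R) (b c : R) : mu.-integrable X (EFin \o u) ->
    mu.-integrable X (EFin \o v) -> mu.-integrable X (EFin \o w) ->
    mu.-integrable X (EFin \o (fun x => b * u x + c * v x + w x)) /\
    \int[mu]_(x in X) (b * u x + c * v x + w x) =
    b * (\int[mu]_(x in X) u x) + c * (\int[mu]_(x in X) v x)
      + \int[mu]_(x in X) w x.
  move=> iu iv iw.
  have ibu : mu.-integrable X (EFin \o (fun x => b * u x)).
    exact: (integrableZl mX b iu).
  have icv : mu.-integrable X (EFin \o (fun x => c * v x)).
    exact: (integrableZl mX c iv).
  have iS : mu.-integrable X (EFin \o (fun x => b * u x + c * v x)).
    exact: (integrableD mX ibu icv).
  split; first exact: (integrableD mX iS iw).
  by rewrite RintegralD// RintegralD// !RintegralZl.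
have [HR1 HR2] := H _ _ _ (complex.Re a) (- complex.Im a) (iR q) (iI q) (iR r).
have [HI1 HI2] := H _ _ _ (complex.Re a) (complex.Im a) (iI q) (iR q) (iI r).
apply/eqP; rewrite eq_complex; apply/andP; split; apply/eqP => /=.
- rewrite (ae_eq_Rint (iR t) HR1) ?HR2.
    case: (a) => a1 a2 /=.
    by rewrite mulNr.
  apply: filterS tE => x tE Xx; rewrite (tE Xx).
  rewrite [(_ + _) x]/(a * L2_fun q x + L2_fun r x).
  move: (a) (L2_fun q x) (L2_fun r x) (L2_fun s x) => [? ?] [? ?] [? ?] [? ?] /=.
  ring.
- rewrite (ae_eq_Rint (iI t) HI1) ?HI2.
    by case: (a).
  apply: filterS tE => x tE Xx; rewrite (tE Xx).
  rewrite [(_ + _) x]/(a * L2_fun q x + L2_fun r x).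
  move: (a) (L2_fun q x) (L2_fun r x) (L2_fun s x) => [? ?] [? ?] [? ?] [? ?] /=.
  ring.
Qed.

Fact L2_inner_conj (q r : L2) : L2_inner r q = ((L2_inner q r)^*)%R.
Proof.
have iI := integrable_Im_prod (L2_sq_integrable q) (L2_sq_integrable r).
apply: (@etrans _ _ ((\int[mu]_(x in X) complex.Re (L2_fun q x * (L2_fun r x)^*)) +i*
  (- \int[mu]_(x in X) complex.Im (L2_fun q x * (L2_fun r x)^*)))) => //.
congr (_ +i* _).
  by apply: eq_Rintegral => x _; rewrite !Re_prodE mulrC [X in _ + X]mulrC.
rewrite -mulN1r -RintegralZl//; apply: eq_Rintegral => x _.
by rewrite !Im_prodE mulN1r opprB mulrC [X in _ - X]mulrC.
Qed.

Fact L2_innerE (q : L2) :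
  L2_inner q q = (\int[mu]_(x in X) sqnormc (L2_fun q x))%:C.
Proof.
congr (_ +i* _).
  by apply: eq_Rintegral => x _; rewrite Re_prodE sqnormcE !expr2.
rewrite (@eq_Rintegral _ _ _ mu X (cst 0)); last first.
  by move=> x _; rewrite Im_prodE mulrC subrr.
by rewrite /Rintegral integral0.
Qed.

Fact L2_inner_ge0 (q : L2) : 0 <= L2_inner q q.
Proof.
by rewrite L2_innerE ler0c; apply: Rintegral_ge0 => x _; exact: sqr_ge0.
Qed.

Fact L2_inner_eq0 (q : L2) : L2_inner q q = 0 -> q = 0.
Proof.
rewrite L2_innerE => /eqP; rewrite eq_complex eqxx andbT/= => /eqP I0.
have /sq_integrableP[_ _ qi] := L2_sq_integrable q.
have : (\int[mu]_(x in X) `|(sqnormc (L2_fun q x))%:E| = 0)%E.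
  under eq_integral do rewrite gee0_abs ?lee_fin ?sqr_ge0//.
  by rewrite -[LHS]fineK ?integrable_fin_num// -[fine _]/(Rintegral _ _ _) I0.
move/(ae_eq_integral_abs mu mX (measurable_int mu qi)) => q0.
have <- : L2_class 0 = 0.
  by apply: (addrI (L2_class 0)); rewrite -L2_class_add !addr0.
rewrite -(L2_reprK q); apply/eq_L2_class.
apply: filterS q0 => x /[apply] -[/eqP].
by rewrite sqrf_eq0 => /eqP /Normc.eq0_normc.
Qed.

HB.instance Definition _ := Lmodule_hasInner.Build R L2
  L2_inner_linearl L2_inner_conj L2_inner_ge0 L2_inner_eq0.
End sq_integrable.

HB.mixin Record CompleteNormedModule_isCStar (R : realType) A
    & CompleteNormedModule R[i] A := {
  cmul : A -> A -> A ;
  cstar : A -> A ;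
  cmulA : associative cmul ;
  cmul_linearl : forall (c : R[i]) (x y z : A),
    cmul (c *: x + y) z = c *: cmul x z + cmul y z ;
  cmul_linearr : forall (c : R[i]) (x y z : A),
    cmul z (c *: x + y) = c *: cmul z x + cmul z y ;
  cstarK : involutive cstar ;
  cstar_antilinear : forall (c : R[i]) (x y : A),
    cstar (c *: x + y) = (c^*)%C *: cstar x + cstar y ;
  cstarM : forall x y : A, cstar (cmul x y) = cmul (cstar y) (cstar x) ;
  cmul_norm : forall x y : A, `|cmul x y| <= `|x| * `|y| ;
  cstar_norm : forall x : A, `|cmul (cstar x) x| = `|x| ^+ 2
}.

(* not necessarily unital: C*(E) has no unit when E has infinitely many vertices *)
#[short(type="cstarAlgType")]
HB.structure Definition CStarAlgebra (R : realType) :=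
  {A of CompleteNormedModule R[i] A & CompleteNormedModule_isCStar R A}.

Definition star_homomorphism (R : realType) (A B : cstarAlgType R)
    (h : A -> B) : Prop :=
  [/\ linear h, {morph h : x y / cmul x y} & {morph h : x / cstar x}].

Record graph := Graph {
  vertex : choiceType ;
  edge : choiceType ;
  rng : edge -> vertex ;
  src : edge -> vertex
}.

Definition out_edges (E : graph) (v : vertex E) : set (edge E) :=
  [set e | src e = v].

(* 0 < #s^{-1}(v) < oo *)
Definition regular_vertex (E : graph) (v : vertex E) : Prop :=
  finite_set (out_edges v) /\ out_edges v !=set0.

Record graph_family (R : realType) (E : graph) (A : cstarAlgType R)
    (P : vertex E -> A) (S : edge E -> A) : Prop := GraphFamily {
  gf_proj : forall v, cmul (P v) (P v) = P v /\ cstar (P v) = P v ;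
  gf_proj_orth : forall v w, v <> w -> cmul (P v) (P w) = 0 ;
  gf_partial_isometry : forall e, cmul (cmul (S e) (cstar (S e))) (S e) = S e ;
  gf_range_orth : forall e f, e <> f ->
    cmul (cmul (S e) (cstar (S e))) (cmul (S f) (cstar (S f))) = 0 ;
  gf_source : forall e, cmul (cstar (S e)) (S e) = P (rng e) ;
  gf_range : forall e,
    cmul (P (src e)) (cmul (S e) (cstar (S e))) = cmul (S e) (cstar (S e)) ;
  gf_regular : forall v, regular_vertex v ->
    P v = \sum_(e \in out_edges v) cmul (S e) (cstar (S e))
}.

Definition generates (R : realType) (E : graph) (A : cstarAlgType R)
    (P : vertex E -> A) (S : edge E -> A) : Prop :=
  forall B : set A, closed B ->
    (forall v, B (P v)) -> (forall e, B (S e)) ->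
    (forall (c : R[i]) x y, B x -> B y -> B (c *: x + y)) ->
    (forall x y, B x -> B y -> B (cmul x y)) ->
    (forall x, B x -> B (cstar x)) -> B = setT.

(* C*(E), as an algebra with generators having the defining universal property *)
Record graph_cstar (R : realType) (E : graph) := GraphCStar {
  gc_alg :> cstarAlgType R ;
  gc_P : vertex E -> gc_alg ;
  gc_S : edge E -> gc_alg ;
  gc_family : graph_family gc_P gc_S ;
  gc_generates : generates gc_P gc_S ;
  gc_universal : forall (B : cstarAlgType R) (Q : vertex E -> B) (T : edge E -> B),
    graph_family Q T -> exists h : gc_alg -> B,
      [/\ star_homomorphism h, forall v, h (gc_P v) = Q v
        & forall e, h (gc_S e) = T e]
}.

Record bounded_operator (R : realType) (V : innerProductType R) :=
  BoundedOperator {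
  bop_linear :> {linear V -> V} ;
  bop_bounded : exists M : R[i], forall x, `|bop_linear x| <= M * `|x|
}.

Definition is_adjoint (R : realType) (V W : innerProductType R)
    (f : V -> W) (g : W -> V) : Prop :=
  forall x y, inner (f x) y = inner x (g y).

(* *-homomorphisms A -> B(V); rep_star says that rep (a^* ) is the adjoint of
   rep a.  Representations need not be nondegenerate. *)
Record representation (R : realType) (A : cstarAlgType R)
    (V : innerProductType R) := Representation {
  rep :> A -> bounded_operator V ;
  rep_linear : forall (c : R[i]) a b x,
    rep (c *: a + b) x = c *: rep a x + rep b x ;
  rep_mul : forall a b x, rep (cmul a b) x = rep a (rep b x) ;
  rep_star : forall a, is_adjoint (rep a) (rep (cstar a))
}.

Section permutative.
Context (R : realType) (V : innerProductType R).

Definition lin_span (B : set V) : set V :=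
  [set x | exists n (c : 'I_n -> R[i]) (b : 'I_n -> V),
     (forall i, B (b i)) /\ x = \sum_i c i *: b i].

Definition orthonormal_set (B : set V) : Prop :=
  forall x y, B x -> B y -> inner x y = (x == y)%:R.

Definition total_orthonormal_set (K B : set V) : Prop :=
  [/\ B `<=` K, orthonormal_set B & K `<=` closure (lin_span B)].

Context (E : graph) (CE : graph_cstar R E) (phi : representation CE V).

Definition vertex_space (v : vertex E) : set V := range (phi (gc_P CE v)).

(* phi (S_e)^* is phi (S_e^* ), by rep_star *)
Definition edge_space (e : edge E) : set V :=
  range (fun x => phi (gc_S CE e) (phi (cstar (gc_S CE e)) x)).

Definition permutative : Prop :=
  exists (Be : edge E -> set V) (Bv : vertex E -> set V),
  [/\ (forall e, total_orthonormal_set (edge_space e) (Be e)) /\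
      (forall v, total_orthonormal_set (vertex_space v) (Bv v)),
      forall v e, out_edges v e -> Be e `<=` Bv v,
      forall v, regular_vertex v -> Bv v = \bigcup_(e in out_edges v) Be e
    & forall e, phi (gc_S CE e) @` Bv (rng e) = Be e].
End permutative.

Section branching_system.
Context d (T : measurableType d) (R : realType).
Context (mu : {measure set T -> \bar R}).

Definition ae_subset (A B : set T) : Prop := mu.-negligible (A `\` B).

Definition ae_eq_set (A B : set T) : Prop := ae_subset A B /\ ae_subset B A.

(* Phi = d(mu \o f)/d mu on D, where (mu \o f)(A) = mu (f(A)).  The image f(A)
   only has to agree a.e. with a measurable set B, and mu (f(A)) is mu B.  Phi is
   real-valued: bs_Phi_mul and bs_Phiinv_mul make the derivatives finite a.e. *)
Definition is_RN_derivative (D : set T) (f : T -> T) (Phi : T -> R) : Prop :=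
  [/\ measurable_fun D Phi, forall x, D x -> 0 <= Phi x
    & forall A, measurable A -> A `<=` D ->
      exists B, [/\ measurable B, ae_eq_set (f @` A) B
                  & mu B = \int[mu]_(x in A) (Phi x)%:E]%E].

(* The maps f_e : D_{r(e)} -> R_e, f_e^{-1} : R_e -> D_{r(e)} and the derivatives
   are total functions whose values outside their domains are irrelevant. *)
Record branching_system (E : graph) (X : set T) := BranchingSystem {
  bs_R : edge E -> set T ;
  bs_D : vertex E -> set T ;
  bs_f : edge E -> T -> T ;
  bs_finv : edge E -> T -> T ;
  bs_Phi : edge E -> T -> R ;
  bs_Phiinv : edge E -> T -> R ;
  bs_R_measurable : forall e, measurable (bs_R e) /\ bs_R e `<=` X ;
  bs_D_measurable : forall v, measurable (bs_D v) /\ bs_D v `<=` X ;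
  bs_R_disjoint : forall e e', e <> e' -> ae_eq_set (bs_R e `&` bs_R e') set0 ;
  bs_D_disjoint : forall v w, v <> w -> ae_eq_set (bs_D v `&` bs_D w) set0 ;
  bs_RD : forall e, ae_subset (bs_R e) (bs_D (src e)) ;
  bs_D_regular : forall v, regular_vertex v ->
    ae_eq_set (bs_D v) (\bigcup_(e in out_edges v) bs_R e) ;
  bs_f_fun : forall e, set_fun (bs_D (rng e)) (bs_R e) (bs_f e) ;
  bs_finv_fun : forall e, set_fun (bs_R e) (bs_D (rng e)) (bs_finv e) ;
  bs_f_measurable : forall e, measurable_fun (bs_D (rng e)) (bs_f e) ;
  bs_finv_measurable : forall e, measurable_fun (bs_R e) (bs_finv e) ;
  bs_f_image : forall e, ae_eq_set (bs_f e @` bs_D (rng e)) (bs_R e) ;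
  bs_fK : forall e, bs_finv e \o bs_f e = id %[ae mu in bs_D (rng e)] ;
  bs_finvK : forall e, bs_f e \o bs_finv e = id %[ae mu in bs_R e] ;
  bs_PhiP : forall e, is_RN_derivative (bs_D (rng e)) (bs_f e) (bs_Phi e) ;
  bs_PhiinvP : forall e, is_RN_derivative (bs_R e) (bs_finv e) (bs_Phiinv e) ;
  bs_Phi_mul : forall e, (fun x => bs_Phiinv e (bs_f e x) * bs_Phi e x)
    = cst 1 %[ae mu in bs_D (rng e)] ;
  bs_Phiinv_mul : forall e, (fun x => bs_Phi e (bs_finv e x) * bs_Phiinv e x)
    = cst 1 %[ae mu in bs_R e]
}.

Definition arises_from (E : graph) (CE : graph_cstar R E) (X : set T)
    (mX : measurable X) (pi : representation CE (L2 mu mX))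
    (F : branching_system E X) : Prop :=
  (forall e q, L2_fun (pi (gc_S CE e) q) =
     (fun x => (\1_(bs_R F e) x * Num.sqrt (bs_Phiinv F e x))%:C
               * L2_fun q (bs_finv F e x)) %[ae mu in X]) /\
  (forall v q, L2_fun (pi (gc_P CE v) q) =
     (fun x => (\1_(bs_D F v) x)%:C * L2_fun q x) %[ae mu in X]).
End branching_system.

(* U^* pi(a) U = phi(a) with U unitary, U^* being named Us *)
Definition unitarily_equivalent (R : realType) (A : cstarAlgType R)
    (V W : innerProductType R) (phi : representation A V)
    (pi : representation A W) : Prop :=
  exists (U : {linear V -> W}) (Us : {linear W -> V}),
    [/\ is_adjoint U Us, cancel U Us, cancel Us U
      & forall a x, Us (pi a (U x)) = phi a x].

Definition discrete_space (T : pointedType) : Type := T.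
HB.instance Definition _ (T : pointedType) := Pointed.on (discrete_space T).
HB.instance Definition _ (T : pointedType) :=
  @isMeasurable.Build default_measure_display (discrete_space T)
    discrete_measurable discrete_measurable0
    discrete_measurableC discrete_measurableU.

Lemma discrete_spaceP (T : pointedType) (L : set (discrete_space T)) :
  measurable L.
Proof. by []. Qed.

Definition counting_measure (T : pointedType) (R : realType) :
  {measure set (discrete_space T) -> \bar R} := @counting (discrete_space T) R.

Definition ell2 (R : realType) (T : pointedType) (L : set (discrete_space T)) :
  innerProductType R := L2 (counting_measure T R) (discrete_spaceP L).

(* Main.v *)
From HB Require Import structures.
Require Import Defs.
From mathcomp Require Import all_boot all_order all_algebra.
From mathcomp Require Import finmap.
From mathcomp Require Import all_classical all_reals all_analysis.
From mathcomp Require Import complex ring lra.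

(** The bases B_v and B_e given by permutativity already are a branching system:
put D_v = B_v and R_e = B_e, and let f_e be the restriction of phi(S_e) to
B_{r(e)}, a bijection onto B_e with inverse the restriction of phi(S_e)^*.  The
spaces H_v are pairwise orthogonal, and so are the H_e; hence so are the bases,
which makes the sets B_v, and the sets B_e, disjoint.  A bijection preserves the
counting measure, so all the Radon-Nikodym derivatives are 1
([permutative_branching]).

The union of the B_v is orthonormal, but it need not span H: a representation may
be degenerate, and the orthogonal complement of the H_v may be nonzero.  The set
Lambda is therefore a maximal orthonormal set containing this union
([maximal_orthonormal]); the points of Lambda outside every B_v lie in no D_v.

Taking coordinates, U x = (b |-> <x, b>), is a unitary from H onto l^2(Lambda)
([coordinate_unitary]).  It rests on Bessel's inequality and on the Riesz-Fischer
theorem, according to which every family g on Lambda whose finite sums of squares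
are at most M is the family of coordinates of a vector y with |y|^2 <= M.
Surjectivity of U is this theorem, and Parseval's identity follows from it by
maximality, since the y built from the coordinates of x can only be x.  To pass
between finite sums and the integrals that define the norm of l^2(Lambda),
integrals for the counting measure are bounded by finite sums from both sides
([sum_le_integral_counting], [integral_counting_le]).

Then pi(a) = U phi(a) U^* is a representation equivalent to phi, and its formula
on generators is read off from coordinates.  For b in Lambda, the coordinate of
phi(S_e) x at b is <x, phi(S_e)^* b>.  When b is in B_e, phi(S_e)^* b is the basis
vector f_e^{-1}(b); otherwise b is orthogonal to B_e, hence to H_e, and
phi(S_e)^* b = 0 ([edge_eq0]).  The projections P_v are treated alike. *)

Set Implicit Arguments.
Unset Strict Implicit.
Unset Printing Implicit Defensive.
Import Order.TTheory GRing.Theory Num.Theory.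
Import numFieldNormedType.Exports.
Local Open Scope classical_set_scope.
Local Open Scope ring_scope.
Local Open Scope complex_scope.

(** * Inner products *)

Lemma sqnormc_ge0 (R : realType) (z : R[i]) : 0 <= sqnormc z.
Proof. exact: sqr_ge0. Qed.

Lemma sqnormcC (R : realType) (z : R[i]) : (sqnormc z)%:C = `|z| ^+ 2.
Proof. by rewrite /sqnormc rmorphXn. Qed.

Lemma gt0_complexE (R : realType) (e : R[i]) : 0 < e ->
  exists2 r : R, 0 < r & e = r%:C.
Proof. by case: e => a b; rewrite ltcE/= => /andP[/eqP-> a0]; exists a. Qed.

Section inner_product.
Context (R : realType) (V : innerProductType R).
Implicit Types x y z : V.

Lemma innerDl x y z : inner (x + y) z = inner x z + inner y z.
Proof. exact: (InnerFactory.fDl inner_linearl). Qed.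

Lemma innerZl a x z : inner (a *: x) z = a * inner x z.
Proof. exact: (InnerFactory.fZl inner_linearl). Qed.

Lemma innerDr x y z : inner z (x + y) = inner z x + inner z y.
Proof. exact: (InnerFactory.fDr inner_linearl inner_conj). Qed.

Lemma innerZr a x z : inner z (a *: x) = (a^*)%C * inner z x.
Proof. exact: (InnerFactory.fZr inner_linearl inner_conj). Qed.

Lemma inner0l z : inner 0 z = 0.
Proof. exact: (InnerFactory.f0l inner_linearl). Qed.

Lemma inner0r z : inner z 0 = 0.
Proof. by rewrite inner_conj inner0l rmorph0. Qed.

Lemma innerBl x y z : inner (x - y) z = inner x z - inner y z.
Proof. by rewrite -scaleN1r innerDl innerZl mulN1r. Qed.

Lemma innerBr x y z : inner z (x - y) = inner z x - inner z y.
Proof. by rewrite !(inner_conj _ z) innerBl rmorphB. Qed.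

Lemma inner_eq0C x y : inner x y = 0 -> inner y x = 0.
Proof. by move=> xy; rewrite inner_conj xy rmorph0. Qed.

Lemma inner_suml (I : Type) (s : seq I) (F : I -> V) z :
  inner (\sum_(i <- s) F i) z = \sum_(i <- s) inner (F i) z.
Proof.
elim: s => [|i s IH]; first by rewrite !big_nil inner0l.
by rewrite !big_cons innerDl IH.
Qed.

Lemma inner_eq0 x : inner x x = 0 -> x = 0.
Proof.
by rewrite inner_norm => /eqP; rewrite expf_eq0/= normr_eq0 => /eqP.
Qed.

Lemma cauchy_schwarz_norm x y : `|inner x y| <= `|x| * `|y|.
Proof.
rewrite -(@ler_pXn2r _ 2)// ?nnegrE ?mulr_ge0// exprMn -!inner_norm.
apply: InnerFactory.cauchy_schwarz.
- exact: inner_linearl.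
- exact: inner_conj.
- by move=> z; rewrite inner_norm exprn_ge0.
- exact: inner_eq0.
Qed.

(** Continuity of the inner product, by way of the Cauchy-Schwarz inequality. *)
Lemma inner_closure_eq0 (K : set V) x z : (forall y, K y -> inner x y = 0) ->
  closure K z -> inner x z = 0.
Proof.
move=> xK Kz; apply/eqP; rewrite -normr_le0; apply/ler_addgt0Pr => e e0.
have e'0 : 0 < e / (`|x| + 1) by rewrite divr_gt0// ltr_wpDl.
have /Kz[w [Kw zw]] : nbhs z (ball z (e / (`|x| + 1))) by exact: nbhsx_ballx.
rewrite add0r (_ : inner x z = inner x (z - w)); last first.
  by rewrite innerBr (xK _ Kw) subr0.
apply: le_trans (cauchy_schwarz_norm _ _) _.
move: zw; rewrite -ball_normE/= => /ltW zw.
rewrite -[leRHS](@divfK _ (`|x| + 1)) ?gt_eqF ?ltr_wpDl// mulrC.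
by rewrite ler_pM// lerDl.
Qed.

Lemma inner_lin_span_eq0 (B : set V) x z : (forall y, B y -> inner x y = 0) ->
  lin_span B z -> inner x z = 0.
Proof.
move=> xB [n [c [b [Bb ->]]]]; rewrite inner_conj inner_suml big1 ?rmorph0// => i _.
by rewrite innerZl inner_conj xB// rmorph0 mulr0.
Qed.

Lemma inner_total_eq0 (K B : set V) x : total_orthonormal_set K B ->
  (forall y, B y -> inner x y = 0) -> forall z, K z -> inner x z = 0.
Proof.
move=> [_ _ KB] xB z /KB; apply: inner_closure_eq0 => y.
exact: inner_lin_span_eq0.
Qed.

Lemma normD_orth x y : inner x y = 0 -> `|x + y| ^+ 2 = `|x| ^+ 2 + `|y| ^+ 2.
Proof.
move=> xy; rewrite -!inner_norm innerDl !innerDr xy (inner_eq0C xy).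
by rewrite addr0 add0r.
Qed.

(** The order of R[i] being partial, real bounds on squared norms are stated on
    the real part. *)
Lemma innerxxE x : inner x x = (complex.Re (inner x x))%:C.
Proof.
have : 0 <= inner x x by rewrite inner_norm exprn_ge0.
by case: (inner x x) => a b; rewrite lecE/= => /andP[/eqP-> _].
Qed.

End inner_product.

Section isometry.
Context (R : realType) (V W : innerProductType R) (U : V -> W).
Hypothesis Ul : linear U.
Hypothesis Un : forall x, inner (U x) (U x) = inner x x.

(** Expanding the norm of x + y recovers <x, y> + <y, x>; replacing x by 'i *: x
    recovers <x, y> - <y, x>. *)
Lemma polarization x y : inner (U x) (U y) = inner x y.
Proof.
have UD u v : U (u + v) = U u + U v by have := Ul 1 u v; rewrite !scale1r.
have U0 : U 0 = 0 by apply: (addrI (U 0)); rewrite -UD !addr0.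
have UZ a u : U (a *: u) = a *: U u by have := Ul a u 0; rewrite U0 !addr0.
have H u v : inner (U u) (U v) + inner (U v) (U u) = inner u v + inner v u.
  have := Un (u + v); rewrite UD !innerDl !innerDr !Un.
  by rewrite -!addrA => /addrI; rewrite !addrA => /addIr.
have i0 : 'i != 0 :> R[i] by rewrite eq_complex/= oner_eq0 andbF.
have iC : ('i^*)%C = - 'i :> R[i] by apply/eqP; rewrite eq_complex/= oppr0 !eqxx.
(* H gives the sum of the two inner products at x, and their difference at 'i *: x. *)
have H1 := H x y; have := H ('i *: x) y.
rewrite UZ !innerZl !innerZr iC !mulNr -!mulrBr => /(mulfI i0) H2.
have E (a b : R[i]) : a = ((a + b) + (a - b)) / 2 by field.
by rewrite (E (inner (U x) _) (inner (U y) (U x))) H1 H2 -E.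
Qed.

End isometry.

(** * Orthonormal sets *)

Section orthonormal.
Context (R : realType) (V : innerProductType R) (B : set V).
Hypothesis oB : orthonormal_set B.
Implicit Types (g : V -> R[i]) (A : {fset V}).

Definition lin_comb g A : V := \sum_(i <- A) g i *: i.
Definition sum_sq g A : R := \sum_(i <- A) sqnormc (g i).

Lemma orthonormal_neq0 x : B x -> x <> 0.
Proof.
move=> Bx x0; have := oB Bx Bx.
by rewrite x0 inner0l eqxx => /eqP; rewrite eq_sym oner_eq0.
Qed.

Lemma sub_orthonormal_orth (C : set V) x b : C `<=` B ->
  B x -> ~ C x -> C b -> inner x b = 0.
Proof.
move=> CB Bx Cx Cb; rewrite oB//; last exact: CB.
by case: eqP => // xb; rewrite xb in Cx.
Qed.

Lemma inner_lin_comb g A b : [set` A] `<=` B -> B b ->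
  inner (lin_comb g A) b = if b \in A then g b else 0.
Proof.
move=> AB Bb; rewrite inner_suml.
have E i : i \in A -> inner (g i *: i) b = if i == b then g i else 0.
  move=> iA; rewrite innerZl oB//; last exact: AB.
  by case: eqP; rewrite ?mulr1 ?mulr0.
rewrite big_seq (eq_bigr _ E) -big_seq -big_mkcond/=.
case: ifPn => bA.
  by rewrite (@fbig_pred1_inj _ _ _ _ _ g id A b).
rewrite big_seq_cond big_pred0// => i; apply/andP => -[iA /eqP ib].
by rewrite -ib iA in bA.
Qed.

Lemma lin_comb_norm g A : [set` A] `<=` B ->
  `|lin_comb g A| ^+ 2 = (sum_sq g A)%:C.
Proof.
move=> AB; rewrite -inner_norm {1}/lin_comb inner_suml /sum_sq rmorph_sum/=.
rewrite big_seq [RHS]big_seq; apply: eq_bigr => i iA.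
rewrite innerZl inner_conj inner_lin_comb//; last exact: AB.
by rewrite iA sqnormcC normCK.
Qed.

(** The combination c of the elements of A with coefficients <x, i> is the
    orthogonal projection of x, so that |x|^2 = |c|^2 + |x - c|^2. *)
Lemma bessel x A : [set` A] `<=` B ->
  (sum_sq (inner x) A)%:C <= `|x| ^+ 2.
Proof.
move=> AB; rewrite -lin_comb_norm//; set c := lin_comb _ A.
have cx : inner c (x - c) = 0.
  rewrite {1}/c inner_suml big_seq big1// => i iA.
  rewrite innerZl innerBr (inner_conj c i) inner_lin_comb ?iA//; last exact: AB.
  by rewrite -inner_conj subrr mulr0.
by rewrite -[in leRHS](subrK c x) addrC normD_orth// lerDl exprn_ge0.
Qed.

End orthonormal.

Lemma big_fsetD (I : choiceType) (U : nmodType) (A C : {fset I}) (F : I -> U) :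
  (A `<=` C)%fset ->
  \sum_(i <- C) F i = \sum_(i <- A) F i + \sum_(i <- (C `\` A)%fset) F i.
Proof.
move=> /fsubsetP AC; rewrite (big_fsetID _ (mem A)).
congr (_ + _); apply: eq_fbigl => i; rewrite !inE//=.
  by apply/andP/idP => [[]//|iA]; split=> //; exact: AC.
by rewrite andbC.
Qed.

(** The vector y is the limit of the combinations of finite subsets of B, along the
    filter of finite subsets ordered by inclusion.  It is a Cauchy filter: if the sum
    over A is within e^2 of the supremum, then enlarging A moves the combination by
    less than e, by orthogonality. *)
Lemma riesz_fischer (R : realType) (H : hilbertType R) (B : set H)
    (g : H -> R[i]) (M : R) : orthonormal_set B ->
  (forall A : {fset H}, [set` A] `<=` B -> sum_sq g A <= M) ->
  exists y, (forall b, B b -> inner y b = g b) /\ `|y| ^+ 2 <= M%:C.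
Proof.
move=> oB gM.
pose D := [set A : {fset H} | [set` A] `<=` B].
pose G (A : {fset H}) := [set C | D C /\ (A `<=` C)%fset].
pose F := filter_from D (fun A => lin_comb g @` G A).
have D0 : D fset0 by move=> x /=; rewrite inE.
have FF : ProperFilter F.
  apply: filter_from_proper; last first.
    by move=> A DA; exists (lin_comb g A), A => //; split.
  apply: filter_from_filter; first by exists fset0.
  move=> A C DA DC; exists (A `|` C)%fset.
    by move=> x /=; rewrite inE => /orP[/DA|/DC].
  move=> _ [E [DE ACE] <-]; move: ACE; rewrite fsubUset => /andP[AE CE].
  by split; exists E.
have cF : cauchy F.
  apply: cauchy_exP => _ /gt0_complexE[e e0 ->].
  pose S := sum_sq g @` D.
  have hS : has_sup S.
    by split; [exists (sum_sq g fset0), fset0|exists M => _ [A DA <-]; exact: gM].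
  have [_ [A DA <-] sA] := sup_adherent (exprn_gt0 2 e0) hS.
  exists (lin_comb g A), A => // _ [C [DC AC] <-].
  rewrite -ball_normE/= distrC.
  have DCA : D (C `\` A)%fset.
    by move=> x /=; rewrite inE => /andP[_ /DC].
  rewrite -(@ltr_pXn2r _ 2)// ?nnegrE ?ler0c ?(ltW e0)//.
  rewrite /lin_comb (big_fsetD _ AC) addrC addKr.
  rewrite (lin_comb_norm oB)// -rmorphXn/= ltcR.
  have : sum_sq g C <= sup S by apply: ub_le_sup; [exact: hS.2|exists C].
  by rewrite /sum_sq (big_fsetD _ AC) -/(sum_sq g A) -/(sum_sq _ _); lra.
have [y Fy] := (cvg_ex F).1 (@cauchy_cvg _ F _ cF).
have yF := (fcvgrPdist_lt y).1 Fy.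
have {}yF e : 0 < e -> exists A, [/\ D A &
    forall C, D C -> (A `<=` C)%fset -> `|y - lin_comb g C| < e].
  move=> /yF[A DA AF]; exists A; split=> // C DC AC; apply: AF.
  by exists C.
exists y; split=> [b Bb|].
  apply/eqP; rewrite -subr_eq0 -normr_le0; apply/ler_addgt0Pr => e e0.
  have [A [DA Ae]] := yF _ e0.
  pose C := (b |` A)%fset.
  have DC : D C by move=> x /=; rewrite !inE => /orP[/eqP->//|/DA].
  have {Ae} := Ae C DC (fsubsetU1 _ _).
  have -> : g b = inner (lin_comb g C) b.
    by rewrite (inner_lin_comb oB)// !inE eqxx.
  rewrite -innerBl add0r => /ltW; apply: le_trans.
  apply: le_trans (cauchy_schwarz_norm _ _) _.
  suff -> : `|b| = 1 by rewrite mulr1.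
  by apply/eqP; rewrite -(@eqrXn2 _ 2)// -inner_norm oB// eqxx expr1n.
have M0 : 0 <= M by apply: le_trans (gM _ D0); rewrite /sum_sq big_seq_fset0.
have -> : M%:C = (Num.sqrt M)%:C ^+ 2 by rewrite -rmorphXn/= sqr_sqrtr.
rewrite ler_pXn2r// ?nnegrE ?ler0c ?sqrtr_ge0//.
apply/ler_addgt0Pr => e /yF[A [DA /(_ A DA (fsubset_refl _)) /ltW]].
move=> Ae; rewrite -(subrK (lin_comb g A) y) addrC.
apply: le_trans (ler_normD _ _) _; apply: lerD => //.
rewrite -(@ler_pXn2r _ 2)// ?nnegrE ?ler0c ?sqrtr_ge0//.
by rewrite (lin_comb_norm oB)// -rmorphXn/= sqr_sqrtr// lecR gM.
Qed.

(** Zorn's lemma.  Maximality is stated in the form in which it is used: a nonzero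
    vector orthogonal to B could be normalized and added to B. *)
Lemma maximal_orthonormal (R : realType) (V : innerProductType R) (B0 : set V) :
  orthonormal_set B0 -> exists B, [/\ B0 `<=` B, orthonormal_set B &
    forall x, (forall b, B b -> inner x b = 0) -> x = 0].
Proof.
move=> oB0.
have [F FP Ftot|A [oA Amax]] :=
    (* The union with B0 makes the empty chain harmless. *)
    @Zorn_bigcup V [set A | orthonormal_set (A `|` B0)].
  move=> x y [[X FX Xx]|Bx] [[Y FY Yy]|By].
  - have [XY|YX] := Ftot _ _ FX FY.
      by apply: (FP _ FY); left => //; exact: XY.
    by apply: (FP _ FX); left => //; exact: YX.
  - by apply: (FP _ FX); [left|right].
  - by apply: (FP _ FY); [right|left].
  - exact: oB0.
exists (A `|` B0); split=> // x xB; apply: contrapT => /eqP x0.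
have nx0 : `|x| != 0 by rewrite normr_eq0.
pose u := `|x|^-1 *: x.
have uB b : (A `|` B0) b -> inner u b = 0 by move=> Bb; rewrite innerZl xB ?mulr0.
have uu : inner u u = 1.
  by rewrite inner_norm normrZ normfV normr_id mulVf// expr1n.
have nAu : ~ A u.
  move=> Au; have := uB u (or_introl Au); rewrite uu => /eqP.
  by rewrite oner_eq0.
apply: (Amax (u |` A)).
  by split=> [|/(_ u (or_introl erefl))//]; exact: subsetUr.
have H a : (u |` A `|` B0) a -> a = u \/ (A `|` B0) a.
  by case=> [[->|Aa]|Ba]; [left|right; left|right; right].
have nu b : (A `|` B0) b -> b <> u.
  by move=> Bb bu; have := uB b Bb; rewrite bu uu => /eqP; rewrite oner_eq0.
move=> a b /H[->|Ba] /H[->|Bb].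
- by rewrite uu eqxx.
- by rewrite uB//; case: eqP => // /esym /(nu b Bb).
- by rewrite inner_conj uB// rmorph0; case: eqP => // /(nu a Ba).
- exact: oA.
Qed.

(** * Counting measure and the space of square summable families *)

Lemma counting_image (R : realType) (T U : choiceType) (f : T -> U) (A : set T) :
  {in A &, injective f} -> counting (f @` A) = counting A :> \bar R.
Proof.
move=> /inj_card_eq fAA; rewrite /counting (eq_finite_set fAA).
case: ifPn => // /asboolP finA; congr (_%:R%:E).
by apply/fcard_eq => //; exact: finite_image.
Qed.

Section counting.
Context (T : pointedType) (R : realType).
Local Notation D := (discrete_space T).
Local Notation mu := (counting_measure T R).

Lemma counting_negligible (A : set D) : mu.-negligible A <-> A = set0.
Proof.
rewrite (negligibleP mu (discrete_spaceP A)).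
split=> [|->]; last exact: measure0.
change (@counting D R A = 0%E -> A = set0).
rewrite /counting; case: ifPn => // /asboolP fA /eqP.
rewrite eqe pnatr_eq0 cardfs_eq0 => /eqP A0.
by rewrite -(fset_setK fA) A0; apply/seteqP; split => x //=; rewrite inE.
Qed.

Lemma ae_counting (P : D -> Prop) : (\forall x \ae mu, P x) <-> forall x, P x.
Proof.
split=> [/counting_negligible P0 x|Px]; last exact: filterE.
by apply: contrapT => nPx; suff : @set0 D x by []; rewrite -P0.
Qed.

Lemma ae_subset_counting (A B : set D) : ae_subset mu A B <-> A `<=` B.
Proof. by rewrite /ae_subset counting_negligible setD_eq0. Qed.

Lemma ae_eq_set_counting (A B : set D) : ae_eq_set mu A B <-> A = B.
Proof.
by rewrite /ae_eq_set !ae_subset_counting; split=> [/seteqP//|->]; split.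
Qed.

Lemma measurable_discrete d (U : sigmaRingType d) (A : set D) (f : D -> U) :
  measurable_fun A f.
Proof. by move=> _ B _; exact: discrete_spaceP. Qed.

(** An injective map preserves the number of elements. *)
Lemma RN_derivative_injective (X : set D) (f : D -> D) : {in X &, injective f} ->
  is_RN_derivative mu X f (cst 1).
Proof.
move=> fI; split=> //.
move=> A _ AX; exists (f @` A); split; first exact: discrete_spaceP.
  exact/ae_eq_set_counting.
rewrite -[RHS]/(\int[mu]_(x in A) cst 1%E x)%E.
rewrite integral_cst ?mul1e; last exact: discrete_spaceP.
apply: counting_image => x y; rewrite !inE => /AX Xx /AX Xy.
by apply: fI; rewrite inE.
Qed.

Lemma integral_set1_counting (h : D -> R) x : 0 <= h x ->
  (\int[mu]_(y in [set x]) (h y)%:E = (h x)%:E)%E.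
Proof.
move=> h0; rewrite (eq_integral (cst (h x)%:E)); last first.
  by move=> y; rewrite inE => ->.
rewrite integral_cst; last exact: discrete_spaceP.
rewrite /= /counting_measure /counting asboolT; last exact: finite_set1.
by rewrite fset_set1 cardfs1 mule1.
Qed.

Lemma integral_fset_counting (h : D -> R) (A : {fset D}) :
  (forall x, 0 <= h x) ->
  (\int[mu]_(x in [set` A]) (h x)%:E = (\sum_(i <- A) h i)%:E)%E.
Proof.
move=> h0; have -> : [set` A] = \big[setU/set0]_(i <- A) [set i].
  by rewrite -bigcup_fset bigcup_imset1 image_id.
rewrite ge0_integral_bigsetU.
- by rewrite -sumEFin; apply: eq_bigr => i _; exact: integral_set1_counting.
- by move=> n; exact: discrete_spaceP.
- exact: fset_uniq.
- by move=> i j _ _ [x [/= -> ->]].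
- exact: measurable_discrete.
- by move=> x _; rewrite lee_fin.
Qed.

Lemma sum_le_integral_counting (h : D -> R) (X : set D) (A : {fset D}) :
  (forall x, 0 <= h x) -> [set` A] `<=` X ->
  ((\sum_(i <- A) h i)%:E <= \int[mu]_(x in X) (h x)%:E)%E.
Proof.
move=> h0 AX; rewrite -integral_fset_counting//.
by apply: ge0_subset_integral => // x _; rewrite lee_fin.
Qed.

(** A finite subset with n elements contributes at least n * r <= M to the sum. *)
Lemma finite_superlevel (h : D -> R) (X : set D) (M r : R) : 0 < r ->
  (forall A : {fset D}, [set` A] `<=` X -> \sum_(i <- A) h i <= M) ->
  finite_set [set x | X x /\ r <= h x].
Proof.
move=> r0 hM; apply: contrapT => /(@infinite_set_fset _ _ (Num.bound (M / r))).
move=> [A AX An]; suff : M / r < M / r by rewrite ltxx.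
apply: lt_le_trans (unstable.ltr_bound _) _.
apply: (@le_trans _ _ (#|` A|)%:R); first by rewrite ler_nat.
rewrite ler_pdivlMr//; apply: le_trans (hM A _); last by move=> x /AX[].
rewrite mulr_natl -iter_addr_0 -count_predT -big_const_seq.
rewrite big_seq [leRHS]big_seq; apply: ler_sum => i iA.
by have [] := AX i iA.
Qed.

Import HBNNSimple.

(** A simple function below h takes finitely many values, and the set where it takes
    a given nonzero value is finite by [finite_superlevel].  Hence its support is
    finite, and its integral is a finite sum. *)
Lemma integral_counting_le (h : D -> R) (X : set D) (M : R) :
  (forall x, 0 <= h x) ->
  (forall A : {fset D}, [set` A] `<=` X -> \sum_(i <- A) h i <= M) ->
  (\int[mu]_(x in X) (h x)%:E <= M%:E)%E.
Proof.
move=> h0 hM; rewrite ge0_integralE; last by move=> x _; rewrite lee_fin.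
apply/ge_ereal_sup => _ [s /= sh <-].
have sX x : s x != 0 -> X x /\ s x <= h x.
  move=> sx; have := sh x; rewrite /patch; case: ifPn => [|_].
    by rewrite inE.
  by rewrite lee_fin => s0; move: sx; rewrite eq_le s0 fun_ge0.
pose S := [set x | s x != 0].
have fS : finite_set S.
  have : finite_set (\bigcup_(r in range s `\ 0) (s @^-1` [set r])).
    apply: bigcup_finite.
      by apply: finite_setD; exact: fimfunP.
    move=> r [[x _ <-] /= /eqP sx0].
    apply: sub_finite_set (finite_superlevel (r := s x) _ hM).
      by move=> y /= yx; rewrite -yx; apply: sX; rewrite yx.
    by rewrite lt0r sx0 fun_ge0.
  apply: sub_finite_set => x Sx; exists (s x) => //; split; first by exists x.
  by move=> /= /eqP; apply/negP.
rewrite -integralT_nnsfun.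
have -> : (\int[mu]_x (s x)%:E = \int[mu]_(x in S) (s x)%:E)%E.
  rewrite [RHS]integral_mkcond; apply: eq_integral => x _.
  by rewrite /patch; case: ifPn => // /negP; rewrite inE /S/= => /negP/negPn/eqP->.
rewrite -(fset_setK fS) integral_fset_counting; last by move=> x; exact: fun_ge0.
rewrite lee_fin; apply: le_trans (hM (fset_set S) _); last first.
  by rewrite fset_setK// => x /sX[].
rewrite big_seq [leRHS]big_seq; apply: ler_sum => i.
by rewrite in_fset_set// inE => /sX[].
Qed.

Lemma eq_ell2 (L : set D) (q r : ell2 R L) :
  q = r <-> {in L, L2_fun q =1 L2_fun r}.
Proof.
rewrite eq_L2 ae_counting; split=> [qr x|qr x Lx]; first by rewrite inE; exact: qr.
by apply: qr; rewrite inE.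
Qed.

Lemma ell2P (L : set D) (g : D -> R[i]) (M : R) :
  (forall A : {fset D}, [set` A] `<=` L -> \sum_(i <- A) sqnormc (g i) <= M) ->
  exists q : ell2 R L, {in L, L2_fun q =1 g}.
Proof.
move=> gM.
have gL2 : g \in sq_integrable mu (discrete_spaceP L).
  rewrite inE; split; [exact: measurable_discrete|exact: measurable_discrete|].
  apply: le_lt_trans (ltry M); apply: integral_counting_le => // x.
  exact: sqnormc_ge0.
exists (L2_class (exist _ g gL2)) => x; rewrite inE.
by have /ae_counting := L2_classK (exist _ g gL2); exact.
Qed.

Lemma ell2_sum_le (L : set D) (q : ell2 R L) (A : {fset D}) : [set` A] `<=` L ->
  (\sum_(i <- A) sqnormc (L2_fun q i))%:C <= inner q q.
Proof.
move=> AL; rewrite [inner q q]L2_innerE lecR -lee_fin.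
have /sq_integrableP[_ _ qi] := L2_sq_integrable q.
rewrite /Rintegral fineK; last exact: integrable_fin_num.
by apply: sum_le_integral_counting => // x; exact: sqnormc_ge0.
Qed.

Lemma ell2_norm_le (L : set D) (q : ell2 R L) (M : R) :
  (forall A : {fset D}, [set` A] `<=` L ->
     \sum_(i <- A) sqnormc (L2_fun q i) <= M) -> inner q q <= M%:C.
Proof.
move=> qM; rewrite [inner q q]L2_innerE lecR -lee_fin.
have /sq_integrableP[_ _ qi] := L2_sq_integrable q.
rewrite /Rintegral fineK; last exact: integrable_fin_num.
by apply: integral_counting_le => // x; exact: sqnormc_ge0.
Qed.

Lemma ell2_linear (L : set D) (a : R[i]) (q r : ell2 R L) :
  {in L, L2_fun (a *: q + r) =1 fun x => a * L2_fun q x + L2_fun r x}.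
Proof. by move=> x; rewrite inE; move/ae_counting : (L2_linear a q r); apply. Qed.

End counting.

(** * Coordinates in a maximal orthonormal set *)

Lemma linear_funP (K : pzRingType) (V W : lmodType K) (f : V -> W) :
  linear f -> exists g : {linear V -> W}, g =1 f.
Proof.
move=> fl; pose m := GRing.isLinear.Build K V W *:%R f fl.
by exists (HB.pack f m : {linear V -> W}).
Qed.

Section coordinates.
Context (R : realType) (H : hilbertType R) (B : set H).
Hypothesis oB : orthonormal_set B.
Hypothesis maxB : forall x, (forall b, B b -> inner x b = 0) -> x = 0.
Local Notation l2 := (@ell2 R H B).

(** For a vector x, [riesz_fischer] gives a y with the coordinates of x and
    |y|^2 <= |U x|^2; then y = x by maximality.  Together with Bessel's inequality
    this makes U isometric. *)
Lemma coordinate_unitary : exists (U : {linear H -> l2}) (Us : {linear l2 -> H}),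
  [/\ forall x, {in B, L2_fun (U x) =1 inner x}, is_adjoint U Us, cancel U Us
    & cancel Us U].
Proof.
have extB x y : (forall b, B b -> inner x b = inner y b) -> x = y.
  move=> xy; apply/eqP; rewrite -subr_eq0; apply/eqP/maxB => b Bb.
  by rewrite innerBl xy// subrr.
have besselB x (A : {fset H}) : [set` A] `<=` B ->
    sum_sq (inner x) A <= complex.Re (inner x x).
  by move=> AB; rewrite -lecR -innerxxE inner_norm; exact: bessel oB _ _ AB.
have /choice[u uE] x : exists q : l2, {in B, L2_fun q =1 inner x}.
  by apply: ell2P => A; exact: besselB.
have surj (q : l2) : exists y, u y = q /\ inner y y <= inner q q.
  have [y [yq yn]] : exists y, (forall b, B b -> inner y b = L2_fun q b) /\
      `|y| ^+ 2 <= (complex.Re (inner q q))%:C.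
    by apply: (riesz_fischer oB) => A AB; rewrite -lecR -innerxxE ell2_sum_le.
  exists y; split; last by rewrite inner_norm (le_trans yn)// -innerxxE.
  by apply/eq_ell2 => b Bb; rewrite uE// yq//; move: Bb; rewrite inE.
have u_inj : injective u.
  move=> x y xy; apply: extB => b Bb; rewrite -[LHS]uE ?inE// xy.
  by apply: uE; rewrite inE.
have ul : linear u.
  move=> a x y; apply/eq_ell2 => b Bb.
  by rewrite uE// ell2_linear// !uE// innerDl innerZl.
have un x : inner (u x) (u x) = inner x x.
  apply/eqP; rewrite eq_le; apply/andP; split.
    rewrite [leRHS]innerxxE; apply: ell2_norm_le => A AB.
    apply: le_trans (besselB x A AB).
    rewrite /sum_sq big_seq [leRHS]big_seq; apply: ler_sum => i iA.
    by rewrite uE// inE; exact: AB.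
  by have [y [/u_inj<- ]] := surj (u x).
have [U UE] := linear_funP ul.
have {}/choice[v vE] (q : l2) : exists y, u y = q.
  by have [y [yq _]] := surj q; exists y.
have vl : linear v.
  by move=> a q r; apply: u_inj; rewrite vE ul !vE.
have [Us UsE] := linear_funP vl.
exists U, Us; split=> [x b Bb|x q|x|q].
- by rewrite UE uE.
- by rewrite UE UsE -[in LHS](vE q) polarization.
- by apply: u_inj; rewrite UsE UE vE.
- by rewrite UE UsE vE.
Qed.

End coordinates.

(** * Representations and the operators of a graph family *)

Lemma conjugate_representation (R : realType) (A : cstarAlgType R)
    (V W : innerProductType R) (phi : representation A V)
    (U : {linear V -> W}) (Us : {linear W -> V}) :
  is_adjoint U Us -> cancel U Us -> cancel Us U ->
  exists pi : representation A W, forall a q, pi a q = U (phi a (Us q)).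
Proof.
move=> adj UK UsK.
have normP (X : innerProductType R) (x : X) (Y : innerProductType R) (y : Y) :
    inner x x = inner y y -> `|x| = `|y|.
  by move=> xy; apply/eqP; rewrite -(@eqrXn2 _ 2)// -!inner_norm xy.
have nU x : `|U x| = `|x| by apply: normP; rewrite adj UK.
have nUs q : `|Us q| = `|q| by rewrite -[in RHS](UsK q) nU.
have bounded a :
    exists M : R[i], forall q, `|(U \o phi a \o Us) q| <= M * `|q|.
  have [M phiM] := bop_bounded (phi a).
  by exists M => q; rewrite /= nU -(nUs q) phiM.
pose op a := @BoundedOperator R W (U \o phi a \o Us : {linear W -> W}) (bounded a).
have opl c a b q : op (c *: a + b) q = c *: op a q + op b q.
  by rewrite /= rep_linear linearP.
have opm a b q : op (cmul a b) q = op a (op b q).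
  by rewrite /= rep_mul UK.
have ops a : is_adjoint (op a) (op (cstar a)).
  move=> q r; rewrite /= adj (rep_star phi) (inner_conj (U _) q) adj.
  by rewrite (inner_conj (Us q)) conjCK.
by exists (Representation opl opm ops).
Qed.

Section graph_operators.
Context (R : realType) (E : graph) (CE : graph_cstar R E).
Context (V : innerProductType R) (phi : representation CE V).
Local Notation S e := (phi (gc_S CE e)).
Local Notation Sx e := (phi (cstar (gc_S CE e))).
Local Notation P v := (phi (gc_P CE v)).

Lemma rep0 x : phi 0 x = 0.
Proof. by have := rep_linear phi (-1) 0 0 x; rewrite scaler0 addr0 scaleN1r addNr. Qed.

Lemma vertex_spaceP v x : vertex_space phi v x <-> P v x = x.
Proof.
split=> [[y _ <-]|<-]; last by exists x.
by rewrite -rep_mul (gf_proj (gc_family CE) v).1.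
Qed.

Lemma edge_spaceP e x : edge_space phi e x <-> S e (Sx e x) = x.
Proof.
split=> [[y _ <-]|<-]; last by exists x.
by rewrite -2!rep_mul (gf_partial_isometry (gc_family CE)).
Qed.

Lemma vertex_adjoint v x y : inner (P v x) y = inner x (P v y).
Proof. by rewrite (rep_star phi) (gf_proj (gc_family CE) v).2. Qed.

Lemma edge_adjointK e x : Sx e (S e x) = P (rng e) x.
Proof. by rewrite -rep_mul (gf_source (gc_family CE)). Qed.

Lemma vertex_orth v w x : v <> w -> vertex_space phi w x -> P v x = 0.
Proof.
move=> vw /vertex_spaceP <-.
by rewrite -rep_mul (gf_proj_orth (gc_family CE))// rep0.
Qed.

Lemma edge_orth e e' x : e <> e' -> edge_space phi e' x -> S e (Sx e x) = 0.
Proof.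
move=> ee' /edge_spaceP <-; rewrite -(rep_mul phi _ _ x) -(rep_mul phi (gc_S CE e)) -rep_mul.
by rewrite (gf_range_orth (gc_family CE))// rep0.
Qed.

(** P_v x is orthogonal to x because the basis spans a dense subspace of H_v; but
    <P_v x, P_v x> = <x, P_v x> for a projection. *)
Lemma vertex_eq0 v x (B : set V) : total_orthonormal_set (vertex_space phi v) B ->
  (forall b, B b -> inner x b = 0) -> P v x = 0.
Proof.
move=> tB xB; apply: inner_eq0; rewrite vertex_adjoint.
apply: (inner_total_eq0 tB xB); apply/vertex_spaceP.
by rewrite -!rep_mul !(gf_proj (gc_family CE) v).1.
Qed.

(** The same argument, with |S_e^* x|^2 = <S_e S_e^* x, x>. *)
Lemma edge_eq0 e x (B : set V) : total_orthonormal_set (edge_space phi e) B ->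
  (forall b, B b -> inner x b = 0) -> Sx e x = 0.
Proof.
move=> tB xB; apply: inner_eq0; rewrite -(rep_star phi).
by apply: inner_eq0C; apply: (inner_total_eq0 tB xB); exists x.
Qed.

Lemma orthonormal_bigcup_vertex (Bv : vertex E -> set V) :
  (forall v, total_orthonormal_set (vertex_space phi v) (Bv v)) ->
  orthonormal_set (\bigcup_v Bv v).
Proof.
move=> tB x y [v _ vx] [w _ wy].
have [vw|/eqP vw] := eqVneq v w.
  by rewrite -vw in wy; have [_ oB _] := tB v; exact: oB.
have [Bv' oB _] := tB v; have [Bw _ _] := tB w.
have xP := (vertex_spaceP v x).1 (Bv' _ vx).
have yP : P v y = 0 by apply: (vertex_orth vw); exact: Bw.
rewrite -[in LHS]xP vertex_adjoint yP inner0r; case: eqP => // xy.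
have := oB _ _ vx vx; rewrite eqxx -[in LHS]xP xy yP inner0l => /eqP.
by rewrite eq_sym oner_eq0.
Qed.

End graph_operators.

(** * The branching system of a permutative representation *)

Section permutative_branching.
Context (R : realType) (E : graph) (CE : graph_cstar R E).
Context (H : hilbertType R) (phi : representation CE H).
Context (Be : edge E -> set H) (Bv : vertex E -> set H).
Hypothesis Be_total : forall e, total_orthonormal_set (edge_space phi e) (Be e).
Hypothesis Bv_total : forall v, total_orthonormal_set (vertex_space phi v) (Bv v).
Hypothesis BeS : forall v e, out_edges v e -> Be e `<=` Bv v.
Hypothesis Bv_regular : forall v, regular_vertex v ->
  Bv v = \bigcup_(e in out_edges v) Be e.
Hypothesis Be_image : forall e, phi (gc_S CE e) @` Bv (rng e) = Be e.
Local Notation S e := (phi (gc_S CE e)).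
Local Notation Sx e := (phi (cstar (gc_S CE e))).

Lemma edge_mapK e : {in Bv (rng e), cancel (S e) (Sx e)}.
Proof.
move=> x; rewrite inE edge_adjointK => Bx.
by apply/vertex_spaceP; have [Bv' _ _] := Bv_total (rng e); exact: Bv'.
Qed.

Lemma edge_mapVK e : {in Be e, cancel (Sx e) (S e)}.
Proof.
move=> x; rewrite inE => Bx.
by apply/edge_spaceP; have [Be' _ _] := Be_total e; exact: Be'.
Qed.

Lemma edge_map_fun e x : Bv (rng e) x -> Be e (S e x).
Proof. by move=> Bx; rewrite -Be_image; exists x. Qed.

Lemma edge_mapV_fun e x : Be e x -> Bv (rng e) (Sx e x).
Proof.
by rewrite -{1}Be_image => -[y By <-]; rewrite edge_mapK// inE.
Qed.

Lemma vertex_basis_disjoint v w : v <> w -> Bv v `&` Bv w = set0.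
Proof.
move=> vw; apply/seteqP; split=> // x [xv xw].
have [Bvv oB _] := Bv_total v; have [Bww _ _] := Bv_total w.
apply: (orthonormal_neq0 oB xv); rewrite -((vertex_spaceP phi v x).1 (Bvv _ xv)).
by rewrite (vertex_orth vw (Bww _ xw)).
Qed.

Lemma edge_basis_disjoint e e' : e <> e' -> Be e `&` Be e' = set0.
Proof.
move=> ee; apply/seteqP; split=> // x [xe xe'].
have [Be1 oB _] := Be_total e; have [Be2 _ _] := Be_total e'.
apply: (orthonormal_neq0 oB xe); rewrite -((edge_spaceP phi e x).1 (Be1 _ xe)).
by rewrite (edge_orth ee (Be2 _ xe')).
Qed.

(** As Lambda may exceed the union of the B_v, the system is built inside any set L
    that contains this union. *)
Lemma permutative_branching (L : set H) : \bigcup_v Bv v `<=` L ->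
  exists F : branching_system (counting_measure H R) E L,
    [/\ bs_R F = Be, bs_D F = Bv, forall e, bs_finv F e = Sx e
      & forall e, bs_Phiinv F e = cst 1].
Proof.
move=> BL.
have ae (Q : H -> Prop) : (forall x, Q x) ->
  \forall x \ae counting_measure H R, Q x by move/ae_counting.
unshelve eexists (@BranchingSystem _ (discrete_space H) R (counting_measure H R) E L
   Be Bv (fun e => S e) (fun e => Sx e) (fun=> cst 1) (fun=> cst 1)
   _ _ _ _ _ _ _ _ _ _ _ _ _ _ _ _ _); last by split.
- move=> e; split; first exact: discrete_spaceP.
  move=> x ex; apply: BL; exists (src e) => //.
  exact: BeS ex.
- move=> v; split; first exact: discrete_spaceP.
  by move=> x vx; apply: BL; exists v.
- by move=> e e' ee; apply/ae_eq_set_counting; exact: edge_basis_disjoint.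
- by move=> v w vw; apply/ae_eq_set_counting; exact: vertex_basis_disjoint.
- by move=> e; apply/ae_subset_counting; exact: BeS.
- by move=> v rv; apply/ae_eq_set_counting; exact: Bv_regular.
- by move=> e x; exact: edge_map_fun.
- by move=> e x; exact: edge_mapV_fun.
- by move=> e; exact: measurable_discrete.
- by move=> e; exact: measurable_discrete.
- by move=> e; apply/ae_eq_set_counting; exact: Be_image.
- by move=> e; apply: ae => x Bx; apply: edge_mapK; rewrite inE.
- by move=> e; apply: ae => x Bx; apply: edge_mapVK; rewrite inE.
- by move=> e; apply: RN_derivative_injective; exact: can_in_inj (@edge_mapK e).
- by move=> e; apply: RN_derivative_injective; exact: can_in_inj (@edge_mapVK e).
- by move=> e; apply: ae => x _; rewrite /= mul1r.
- by move=> e; apply: ae => x _; rewrite /= mul1r.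
Qed.

End permutative_branching.

(* Lambda is a subset of a type T, since T itself cannot be empty. *)
Theorem theorem2p6 (R : realType) (E : graph) (CE : graph_cstar R E)
    (H : hilbertType R) (phi : representation CE H) (hphi : permutative phi) :
  exists (T : pointedType) (Lambda : set (discrete_space T))
    (F : branching_system (counting_measure T R) E Lambda)
    (pi : representation CE (ell2 R Lambda)),
    arises_from pi F /\ unitarily_equivalent phi pi.
Proof.
have [Be [Bv [[tBe tBv] BeS Breg Bimg]]] := hphi.
have [L [BL oL maxL]] := maximal_orthonormal (orthonormal_bigcup_vertex tBv).
have BeL e : Be e `<=` L.
  by move=> x ex; apply: BL; exists (src e) => //; exact: BeS ex.
have BvL v : Bv v `<=` L by move=> x vx; apply: BL; exists v.
have [F [FR FD Ff FPhi]] := permutative_branching tBe tBv BeS Breg Bimg BL.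
have [U [Us [UE adj UK UsK]]] := coordinate_unitary oL maxL.
have [pi piE] := conjugate_representation phi adj UK UsK.
have UsE q b : L b -> inner (Us q) b = L2_fun q b.
  by move=> Lb; rewrite -[in RHS](UsK q) UE// inE.
exists H, L, F, pi; split; last first.
  by exists U, Us; split=> // a x; rewrite piE !UK.
split=> [e q|v q]; apply/ae_counting => x Lx; rewrite piE UE ?inE//.
- rewrite (rep_star phi) FR Ff FPhi sqrtr1 mulr1 indicE.
  have [xe|xe] := boolP (x \in Be e).
    rewrite mul1r UsE//; apply: BvL; apply: (edge_mapV_fun tBv Bimg).
    exact: set_mem xe.
  rewrite mul0r (edge_eq0 (tBe e)) ?inner0r// => b eb.
  apply: (sub_orthonormal_orth oL (BeL e)) => //.
  by move=> /mem_set; exact/negP.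
- rewrite vertex_adjoint FD indicE.
  have [xv|xv] := boolP (x \in Bv v).
    have [Bv' _ _] := tBv v.
    by rewrite mul1r ((vertex_spaceP _ _ _).1 (Bv' _ (set_mem xv))) UsE.
  rewrite mul0r (vertex_eq0 (tBv v)) ?inner0r// => b vb.
  apply: (sub_orthonormal_orth oL (BvL v)) => //.
  by move=> /mem_set; exact/negP.
Qed.
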